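(* If Sarnak's conjecture is true, then for every topological dynamical system $(X,T)$ of zero topological entropy and every $f\in C(X)$, $$\frac1N\sum_{n\le N}f(T^nx)\boldsymbol{\mu}(n)\longrightarrow0\quad(N\to\infty)$$ uniformly in $x\in X$.
   Context: A topological dynamical system $(X,T)$ is a compact metric space $X$ with a continuous map $T\colon X\to X$. $\boldsymbol{\mu}$ is the Möbius function. Sarnak's conjecture is the statement: for every topological dynamical system $(X,T)$ of zero topological entropy, every $f\in C(X)$ and every $x\in X$, $\frac1N\sum_{n\le N}f(T^nx)\boldsymbol{\mu}(n)\to0$ as $N\to\infty$. *)

(* Defs.v *)
From HB Require Import structures.
From mathcomp Require Import all_boot all_order all_algebra finmap complex.
From mathcomp Require Import all_classical all_reals all_analysis.

Set Implicit Arguments.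
Unset Strict Implicit.
Unset Printing Implicit Defensive.

Import Order.TTheory GRing.Theory Num.Theory.
Import numFieldNormedType.Exports.

Local Open Scope classical_set_scope.
Local Open Scope ring_scope.
Local Open Scope complex_scope.

(* The library puts no topology on [R[i]]; it receives here the topology of
   the modulus, as every numFieldType does. *)
HB.instance Definition _ (R : realType) :=
  PseudoMetricNormedZmod.copy R[i] R[i]^o.

(* [mobius 0] is a junk value: 0. *)
Definition mobius (n : nat) : int :=
  if (0 < n)%N && all (fun p => logn p n == 1%N) (primes n)
  then (-1) ^+ size (primes n) else 0.

Definition is_tds (R : realType) (X : metricType R) (T : X -> X) : Prop :=
  compact [set: X] /\ continuous T.

Section Entropy.
Context {R : realType} {X : metricType R}.
Implicit Types (T : X -> X) (n : nat) (e : R).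

Definition bowen_dist T n (x y : X) : R :=
  \big[Num.max/0]_(i < n) mdist (iter i T x) (iter i T y).

Definition spanning T n e (F : {fset X}) : Prop :=
  forall x : X, exists2 y : X, y \in F & bowen_dist T n x y < e.

Definition spanning_number T n e : \bar R :=
  ereal_inf [set (#|` F|)%fset%:R%:E | F in [set F | spanning T n e F]].

(* Bowen's definition. The growth rate is nonincreasing in e, so that the
   supremum over e > 0 is the limit as e tends to 0. The empty system has
   entropy -oo, as lne 0 = -oo. *)
Definition topological_entropy T : \bar R :=
  ereal_sup [set limn_esup (fun n => (n%:R^-1)%:E * lne (spanning_number T n e))%E
            | e in [set e | 0 < e]].

End Entropy.

Definition mobius_average (R : realType) (X : Type) (T : X -> X)
    (f : X -> R[i]) (N : nat) (x : X) : R[i] :=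
  N%:R^-1 * \sum_(1 <= n < N.+1) f (iter n T x) * (mobius n)%:~R.

Definition Sarnak_conjecture (R : realType) : Prop :=
  forall (X : metricType R) (T : X -> X), is_tds T ->
    topological_entropy T = 0%E ->
  forall f : X -> R[i], continuous f ->
  forall x : X, mobius_average T f N x @[N --> \oo] --> (0 : R[i]).

(* Main.v *)
(** Suppose uniformity fails: |avg_{N_k}(x_k)| >= e for some N_k -> oo and points
    x_k, where the N_k may be taken to grow by any prescribed factor.  Let y be the
    sequence in X that follows the orbit of x_k, without shifting time, for
    N_{k-1} < n <= N_k.  Since N_k at least doubles, a window [j, j + n) with j >= n
    meets at most one switch between orbits, so the shift on the orbit closure of y
    has spanning numbers at most (2n + 1) S_n^2, where S_n is a spanning number of
    (X, T) at a smaller scale; its entropy is therefore zero.  Sarnak's conjecture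
    for this shift, at the point y and for the function w |-> f (w 0), says that
    the averages along y tend to 0.  But at time N_k they differ from
    avg_{N_k}(x_k) by at most 2 |f| N_{k-1} / N_k <= e / 2. *)
From HB Require Import structures.
Require Import Defs.
From mathcomp Require Import all_boot all_order all_algebra finmap complex.
From mathcomp Require Import all_classical all_reals all_analysis.
From mathcomp Require Import lra zify.
Import Order.TTheory GRing.Theory Num.Theory.
Import numFieldNormedType.Exports.
Local Open Scope classical_set_scope.
Local Open Scope ring_scope.
Local Open Scope complex_scope.

Set Implicit Arguments.
Unset Strict Implicit.
Unset Printing Implicit Defensive.


(** * The shift on the orbit closure of a sequence *)

Section OrbitClosure.
Context {R : realType} {X : metricType R}.
Implicit Types (y v w : nat -> X).

(* The truncation at 1/(i+1) makes this a metric for the product topology. *)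
Definition seq_dist v w : R :=
  sup [set Num.min (mdist (v i) (w i)) i.+1%:R^-1 | i in [set: nat]].

Lemma seq_dist_term v w i :
  Num.min (mdist (v i) (w i)) i.+1%:R^-1 <= seq_dist v w.
Proof.
apply: ub_le_sup; last by exists i.
by exists 1 => _ [j _ <-]; rewrite ge_min invf_le1 ?ler1n ?orbT.
Qed.

Lemma seq_dist_le v w (e : R) :
  (forall i, Num.min (mdist (v i) (w i)) i.+1%:R^-1 <= e) -> seq_dist v w <= e.
Proof.
move=> le_e; apply: ge_sup; last by move=> _ [j _ <-].
by exists (Num.min (mdist (v 0) (w 0)) 1%:R^-1), 0.
Qed.

(** Because of the truncation, the coordinates from [L] on contribute at most 1/(L+1). *)
Lemma seq_dist_le_prefix v w (L : nat) (e : R) : 0 <= e -> L.+1%:R^-1 <= e ->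
  (forall i, (i < L)%N -> mdist (v i) (w i) <= e) -> seq_dist v w <= e.
Proof.
move=> e0 Le vw; apply: seq_dist_le => i; rewrite ge_min.
case: (ltnP i L) => [/vw -> //|Li]; apply/orP; right.
by apply: le_trans Le; rewrite lef_pV2 ?posrE// ler_nat ltnS.
Qed.

Lemma seq_dist_coord v w i (e : R) : seq_dist v w < e -> e <= i.+1%:R^-1 ->
  mdist (v i) (w i) < e.
Proof.
move=> /(le_lt_trans (seq_dist_term v w i)); rewrite gt_min => /orP[//|ei].
by rewrite leNgt ei.
Qed.

Lemma seq_distxx v : seq_dist v v = 0.
Proof.
apply/eqP; rewrite eq_le; apply/andP; split.
  by apply: seq_dist_le => i; rewrite mdistxx ge_min lexx.
by apply: le_trans (seq_dist_term v v 0); rewrite mdistxx le_min lexx invr_ge0 ler0n.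
Qed.

Lemma seq_dist_eq0 v w : seq_dist v w = 0 -> v = w.
Proof.
move=> vw0; apply/funext => i; apply: mdist_positivity.
have := seq_dist_term v w i; rewrite vw0 ge_min => /orP[d0|].
  by apply/eqP; rewrite eq_le d0 mdist_ge0.
by rewrite leNgt invr_gt0 ltr0Sn.
Qed.

Lemma seq_distC v w : seq_dist v w = seq_dist w v.
Proof.
by congr sup; apply/seteqP; split => _ [i _ <-]; exists i; rewrite // metric_sym.
Qed.

Lemma seq_dist_triangle w v u : seq_dist v u <= seq_dist v w + seq_dist w u.
Proof.
apply: seq_dist_le => i.
apply: le_trans (lerD (seq_dist_term v w i) (seq_dist_term w u i)).
have i0 : 0 <= i.+1%:R^-1 :> R by rewrite invr_ge0 ler0n.
move: (metric_triangle (v i) (w i) (u i)) i0.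
move: (mdist_ge0 (v i) (w i)) (mdist_ge0 (w i) (u i)).
move: (mdist (v i) (u i)) (mdist (v i) (w i)) (mdist (w i) (u i)) (_^-1).
move=> a b c r b0 c0 abc r0; rewrite ge_min.
case: (leP b r) => br; case: (leP c r) => cr; apply/orP;
  by [left; lra | right; lra].
Qed.

(* The closure of {shift^j y | j} in X^nat, described by finite windows. *)
Definition orbit_closure y : Type :=
  {w : nat -> X | forall (L : nat) (e : R), 0 < e ->
    exists j, forall i, (i < L)%N -> mdist (w i) (y (i + j)%N) < e}.

HB.instance Definition _ y := gen_eqMixin (orbit_closure y).
HB.instance Definition _ y := gen_choiceMixin (orbit_closure y).

Section Metric.
Variable y : nat -> X.

Let d (v w : orbit_closure y) := seq_dist (sval v) (sval w).

Let dxx (v : orbit_closure y) : d v v = 0. Proof. exact: seq_distxx. Qed.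

Let d_eq0 (v w : orbit_closure y) : d v w = 0 -> v = w.
Proof.
case: v w => [v vP] [w wP] /seq_dist_eq0 /= vw.
by subst w; congr exist; exact: Prop_irrelevance.
Qed.

Let dC (v w : orbit_closure y) : d v w = d w v. Proof. exact: seq_distC. Qed.

Let d_triangle (w v u : orbit_closure y) : d v u <= d v w + d w u.
Proof. exact: seq_dist_triangle. Qed.

HB.instance Definition _ :=
  isMetric.Build R (orbit_closure y) dxx d_eq0 dC d_triangle.

End Metric.

Lemma orbit_closure_mdistE y (v w : orbit_closure y) :
  mdist v w = seq_dist (sval v) (sval w).
Proof. by []. Qed.

(** Tychonoff's argument: an ultrafilter converges in each coordinate, hence uniformly on every
    finite window, which puts the limit [p] into the orbit closure. *)
Lemma orbit_closure_compact y :
  compact [set: X] -> compact [set: orbit_closure y].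
Proof.
move=> cX; rewrite compact_ultra => F FU _.
have lim i : {p : X | (fun w : orbit_closure y => sval w i) @ F --> p}.
  apply: cid; have FF : ProperFilter F := ultra_proper.
  have [//|p [_ clp]] := cX ((fun w : orbit_closure y => sval w i) @ F) _.
    exact: filterT.
  (* If the preimage of [A] were not in [F], its complement would be, and clustering at [p] would
     make [A] meet its complement. *)
  exists p => A pA; have [//|nA] := @in_ultra_setVsetC _ F
    ((fun w : orbit_closure y => sval w i) @^-1` A) FU.
  by have [x []] := clp (~` A) A nA pA.
pose p i := sval (lim i).
have near_p (L : nat) (e : R) : 0 < e ->
    F [set w : orbit_closure y | forall i, (i < L)%N -> mdist (p i) (sval w i) < e].
  move=> e0; elim: L => [|L IH]; first by apply: filterS filterT => w _ i; rewrite ltn0.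
  have /= FL : F [set w : orbit_closure y | mdist (p L) (sval w L) < e].
    have := svalP (lim L) (ball (p L) e) (nbhsx_ballx _ _ e0).
    by rewrite ballEmdist.
  apply: filterS (filterI IH FL) => w /= [wi wL] i.
  by rewrite ltnS leq_eqVlt => /predU1P[->//|/wi].
have pP (L : nat) (e : R) : 0 < e ->
    exists j, forall i, (i < L)%N -> mdist (p i) (y (i + j)%N) < e.
  move=> e0; have e20 : 0 < e / 2 by rewrite divr_gt0.
  have /filter_ex[w /= pw] := near_p L _ e20.
  have [j wj] := svalP w L _ e20; exists j => i iL.
  rewrite (splitr e) (le_lt_trans (metric_triangle _ (sval w i) _))//.
  by rewrite ltrD ?pw ?wj.
pose q : orbit_closure y := exist _ p pP.
exists q; split => // A /nbhs_ballP[e /= e0 qA].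
have e20 : 0 < e / 2 by rewrite divr_gt0.
have [L Le] : exists L : nat, L.+1%:R^-1 <= e / 2.
  exists (Num.truncn (e / 2)^-1).
  by rewrite -[leRHS]invrK lef_pV2 ?posrE ?invr_gt0// ltW// truncnS_gt.
apply: filterS (near_p L _ e20) => w pw; apply: qA; rewrite ballEmdist /=.
apply: (@le_lt_trans _ _ (e / 2)); last by rewrite ltr_pdivrMr// ltr_pMr// ltr1n.
rewrite orbit_closure_mdistE; apply: (@seq_dist_le_prefix _ _ L) => //.
  exact: ltW.
by move=> i iL; exact/ltW/pw.
Qed.

Lemma orbit_shift_subproof y (w : orbit_closure y) (L : nat) (e : R) : 0 < e ->
  exists j, forall i, (i < L)%N -> mdist (sval w i.+1) (y (i + j)%N) < e.
Proof.
move=> e0; have [j wj] := svalP w L.+1 _ e0; exists j.+1 => i iL.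
by rewrite addnS -addSn wj.
Qed.

Definition orbit_shift y (w : orbit_closure y) : orbit_closure y :=
  exist _ (fun i => sval w i.+1) (orbit_shift_subproof w).

Lemma iter_orbit_shiftE y (w : orbit_closure y) n i :
  sval (iter n (@orbit_shift y) w) i = sval w (i + n)%N.
Proof. by elim: n w i => [|n IH] w i; rewrite ?addn0//= IH addnS addSn. Qed.

(** The factor 2 absorbs the shift of the truncation levels: 1/(i+1) <= 2/(i+2). *)
Lemma seq_dist_shift v w :
  seq_dist (fun i => v i.+1) (fun i => w i.+1) <= 2 * seq_dist v w.
Proof.
apply: seq_dist_le => i.
have := seq_dist_term v w i.+1; rewrite ge_min => /orP[vw|iD].
  rewrite ge_min; apply/orP; left; have := mdist_ge0 (v i.+1) (w i.+1); lra.
rewrite ge_min; apply/orP; right.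
apply: le_trans (ler_wpM2l (ler0n _ 2) iD).
rewrite -[_ * _^-1]invrK invfM invrK lef_pV2 ?posrE ?mulr_gt0 ?invr_gt0//.
by rewrite mulrC ler_pdivrMr// -natrM ler_nat muln2 -addnn !addSn !addnS !ltnS leq_addr.
Qed.

Lemma orbit_shift_continuous y : continuous (@orbit_shift y).
Proof.
move=> w A /nbhs_ballP[e /= e0 wA]; apply/nbhs_ballP; exists (e / 2) => /=.
  by rewrite divr_gt0.
move=> v; rewrite ballEmdist /= => wv; apply: wA.
rewrite ballEmdist /= (le_lt_trans (seq_dist_shift _ _))//.
by rewrite mulrC -ltr_pdivlMr.
Qed.

Lemma orbit_shift_tds y : compact [set: X] -> is_tds (@orbit_shift y).
Proof.
by move=> cX; split; [exact: orbit_closure_compact | exact: orbit_shift_continuous].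
Qed.

Lemma coord0_continuous y (Y : topologicalType) (f : X -> Y) :
  continuous f -> continuous (fun w : orbit_closure y => f (sval w 0%N)).
Proof.
move=> cf w A /cf /nbhs_ballP[e /= e0 wA]; apply/nbhs_ballP.
(* Coordinate 0 is truncated at 1, so the truncation is inactive below 1. *)
exists (Num.min e 1) => /=; first by rewrite lt_min e0 ltr01.
move=> v; rewrite ballEmdist /= => wv; apply: wA; rewrite ballEmdist /=.
apply: lt_le_trans (seq_dist_coord wv _) _; first by rewrite invr1 ge_min lexx orbT.
by rewrite ge_min lexx.
Qed.

End OrbitClosure.


(** * Zero entropy as subexponential growth of spanning sets *)

Section Entropy.
Context {R : realType} {X : metricType R}.
Implicit Types (T : X -> X) (n : nat) (e : R).

Lemma bowen_dist_ltP T n e x y : 0 < e ->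
  bowen_dist T n x y < e <->
  forall i, (i < n)%N -> mdist (iter i T x) (iter i T y) < e.
Proof.
move=> e0; split=> [/Order.TotalTheory.bigmax_ltP[_ lt_e] i ni|lt_e].
  exact: (lt_e (Ordinal ni)).
by apply/Order.TotalTheory.bigmax_ltP; split=> // i _; apply: lt_e.
Qed.

(* A spanning set must lie in the space, whereas a natural cover has its centres
   elsewhere: one point is picked in every nonempty cell. *)
Lemma spanning_of_cover T n e (I : finType) (Q : I -> X -> Prop) :
  (forall x, exists i, Q i x) ->
  (forall i x y, Q i x -> Q i y -> bowen_dist T n x y < e) ->
  exists2 F, spanning T n e F & (#|` F| <= #|I|)%N.
Proof.
move=> cov close; have [[x0]|noX] := pselect (inhabited X); last first.
  by exists fset0 => [x|]; [case: noX; constructor | rewrite cardfs0].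
have g_ i : {x | (exists x, Q i x) -> Q i x}.
  apply: cid; have [[x Qx]|nQ] := pselect (exists x, Q i x).
    by exists x.
  by exists x0.
exists [fset sval (g_ i) | i in I]%fset => [x|].
  have [i Qx] := cov x; exists (sval (g_ i)); first exact: in_imfset.
  by apply: (close i _ _ Qx); apply: (svalP (g_ i)); exists x.
by rewrite (leq_trans (leq_imfset_card _ _ _))// cardE; apply: uniq_leq_size => [|i _]; rewrite ?enum_finmem_uniq ?mem_enum.
Qed.

Lemma spanning_number_ge0 T n e : (0 <= spanning_number T n e)%E.
Proof. by apply: le_ereal_inf_tmp => _ [G _ <-]; rewrite lee_fin ler0n. Qed.

Lemma le_invn_lne n (s : \bar R) (h : R) : 0 < n%:R :> R -> (0 <= s)%E ->
  ((n%:R^-1)%:E * lne s <= h%:E)%E = (s <= (expR (h * n%:R))%:E)%E.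
Proof.
move=> n0 s0; rewrite lee_pdivrMl// -EFinM mulrC -[X in X%:E]expRK.
by rewrite -lne_EFin ?expR_gt0// lee_lne// ?in_itv/= ?leey ?s0 ?lee_fin ?expR_ge0.
Qed.

Lemma lt_invn_lne n (s : \bar R) (h : R) : 0 < n%:R :> R -> (0 <= s)%E ->
  ((n%:R^-1)%:E * lne s < h%:E)%E = (s < (expR (h * n%:R))%:E)%E.
Proof.
move=> n0 s0; rewrite lte_pdivrMl// -EFinM mulrC -[X in X%:E]expRK.
by rewrite -lne_EFin ?expR_gt0// lte_lne// ?in_itv/= ?leey ?s0 ?lee_fin ?expR_ge0.
Qed.

(** The point [x0] makes spanning sets nonempty, so the logarithms of their sizes are nonnegative;
    the empty system satisfies the growth condition with entropy -oo. *)
Lemma topological_entropy_eq0P T (x0 : X) :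
  topological_entropy T = 0%E <->
  forall e h : R, 0 < e -> 0 < h -> \forall n \near \oo,
    exists2 F, spanning T n e F & #|` F|%fset%:R <= expR (h * n%:R).
Proof.
split=> [ent0 e h e0 h0|growth].
  set u := (fun n => (n%:R^-1)%:E * lne (spanning_number T n e))%E.
  have : (limn_esup u < h%:E)%E.
    apply: (@le_lt_trans _ _ 0%E); last by rewrite lte_fin.
    by rewrite -ent0; apply: ereal_sup_ubound; exists e.
  move=> /ereal_inf_lt[_ [V [N _ NV] <-] supV].
  (* [N.+1] excludes n = 0, where the factor n^-1 is the default value 0. *)
  exists N.+1 => // n /= Nn; have n0 : 0 < n%:R :> R by rewrite ltr0n; lia.
  have un : (u n < h%:E)%E.
    apply: le_lt_trans supV; apply: ereal_sup_ubound; exists n => //.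
    by apply: NV; rewrite /=; lia.
  have /ereal_inf_lt[_ [F spF <-] Fn] :
      (spanning_number T n e < (expR (h * n%:R))%:E)%E.
    by rewrite -lt_invn_lne// spanning_number_ge0.
  by exists F => //; rewrite ltW// -lte_fin.
apply/eqP; rewrite eq_le; apply/andP; split.
  apply: ge_ereal_sup => _ [e /= e0 <-]; apply/lee_addgt0Pr => h h0; rewrite add0e.
  have [N _ NF] := growth e h e0 h0.
  apply: ge_ereal_inf.
  exists (ereal_sup ((fun n => (n%:R^-1)%:E * lne (spanning_number T n e))%E
                      @` [set n | (N.+1 <= n)%N])).
    by exists [set n | (N.+1 <= n)%N] => //; exists N.+1.
  apply: ge_ereal_sup => _ [n /= Nn <-].
  have n0 : 0 < n%:R :> R by rewrite ltr0n; lia.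
  have [|F spF Fh] := NF n; first by rewrite /=; lia.
  rewrite le_invn_lne ?spanning_number_ge0//.
  by apply: ge_ereal_inf; exists (#|` F|%fset%:R%:E); [exists F|rewrite lee_fin].
apply: le_trans (ereal_sup_ubound _); last by exists 1; rewrite /= ?ltr01.
apply: le_ereal_inf_tmp => _ [V [N _ NV] <-].
apply: le_trans (ereal_sup_ubound _); last by exists N => //; apply: NV => /=.
rewrite mule_ge0 ?lee_fin ?invr_ge0// lne_ge0.
apply: le_ereal_inf_tmp => _ [G spG <-]; rewrite lee_fin ler1n cardfs_gt0.
by have [y yG _] := spG x0; apply/fset0Pn; exists y.
Qed.

(** From exp t >= 1 + t^2/2 at t = h n: the quadratic term is at least 2 n once n >= 4/h^2. *)
Lemma linear_le_expR (h : R) : 0 < h ->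
  \forall n \near \oo, (2 * n + 1)%N%:R <= expR (h * n%:R).
Proof.
move=> h0; have [N _ NP] := nbhs_infty_ger (4 / h ^+ 2).
exists N => // n /= /NP /= nh.
apply: le_trans (expR_ge1Dxn 1 _); last by rewrite mulr_ge0 ?ler0n// ltW.
rewrite natrD natrM addrC lerD2l (_ : 2`! = 2)%N// ler_pdivlMr ?ltr0n//.
rewrite exprMn expr2 [n%:R ^+ 2]expr2.
move: nh; rewrite ler_pdivrMr ?exprn_gt0// expr2.
have := ler0n R n; move: (n%:R : R) => x x0 hx.
by have := ler_wpM2l x0 hx; lra.
Qed.

End Entropy.

(** * Entropy of the shift for a sequence with rare switches *)

Lemma bowen_dist_orbit_shift_lt {R : realType} {X : metricType R} (y : nat -> X)
    (v w : orbit_closure y) (n L : nat) (d e : R) :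
  0 < d -> d < e -> L.+1%:R^-1 <= d ->
  (forall i, (i < n + L)%N -> mdist (sval v i) (sval w i) <= d) ->
  bowen_dist (@orbit_shift R X y) n v w < e.
Proof.
move=> d0 de Ld vw; apply/bowen_dist_ltP; first exact: lt_trans de.
move=> i ni; apply: le_lt_trans de; rewrite orbit_closure_mdistE.
(* Each of the [n] shifts reads a window of length [L], inside the coordinates below n + L. *)
apply: (@seq_dist_le_prefix _ _ _ _ L) => //; first exact: ltW.
by move=> j jL; rewrite !iter_orbit_shiftE vw//; lia.
Qed.

Section OneSwitch.
Context {R : realType} {X : metricType R}.
Variables (T : X -> X) (y : nat -> X).

(** Taking [m] at least [n] covers windows without a switch. Windows with j < n may contain many
    switches and are left out. *)
Hypothesis y_switch : forall n j, (n <= j)%N ->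
  exists m a b, forall i, (i < n)%N ->
    y (i + j)%N = iter i T (if (i < m)%N then a else b).

Lemma orbit_closure_spanning (n L : nat) (d e : R) (F : {fset X}) :
  0 < d -> 4 * d < e -> L.+1%:R^-1 <= 4 * d -> spanning T (n + L) d F ->
  exists2 G, spanning (@orbit_shift R X y) n e G &
    (#|` G| <= (n + L) + (n + L).+1 * (#|` F| * #|` F|))%N.
Proof.
move=> d0 de Ld spF.
(* A window of w is close either to a window of y starting before n + L, or to
   one starting later, with its switching time m and its two orbit pieces. *)
pose I : finType := ('I_(n + L) + 'I_(n + L).+1 * (F * F))%type.
pose g (i : I) : nat -> X := match i with
  | inl j => fun k => y (k + j)%N
  | inr (m, (a, b)) => fun k => iter k T (if (k < m)%N then fsval a else fsval b)
  end.
(* One [d] pays for replacing [w] by a window of [y], the other for replacing the orbit pieces by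
   those of points of [F]; two sequences in one cell are then less than [4 * d] apart in each
   coordinate of the window. *)
pose Q i (w : orbit_closure y) :=
  forall k, (k < n + L)%N -> mdist (sval w k) (g i k) < 2 * d.
have [|i v w Qv Qw|G spG cG] := @spanning_of_cover _ _ (@orbit_shift R X y) n e I Q.
- move=> w; have [j wj] := svalP w (n + L)%N _ d0.
  case: (ltnP j (n + L)) => [jn|nj].
    by exists (inl (Ordinal jn)) => k kn /=; have := wj k kn; lra.
  have [m [a [b yE]]] := y_switch nj.
  have [a' aF aa'] := spF a; have [b' bF bb'] := spF b.
  (* All switching times beyond the window have the same effect, so [m] is capped at n + L. *)
  have m'P : (minn m (n + L) < (n + L).+1)%N by rewrite ltnS geq_minr.
  exists (inr (Ordinal m'P, ([` aF]%fset, [` bF]%fset))) => k kn /=.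
  have := wj k kn; rewrite yE// leq_min kn andbT => wk.
  apply: le_lt_trans (metric_triangle _ (iter k T (if (k < m)%N then a else b)) _) _.
  rewrite mulr_natl mulr2n ltrD//.
  by case: ifP => _; move: k kn {wk}; apply/bowen_dist_ltP.
- apply: (bowen_dist_orbit_shift_lt _ de Ld); first by rewrite mulr_gt0.
  move=> k kn; apply: le_trans (metric_triangle _ (g i k) _) _.
  have := Qv k kn; have := Qw k kn; rewrite (metric_sym (sval w k)); lra.
- exists G => //; apply: leq_trans cG _.
  by rewrite card_sum !card_prod !card_ord -cardfE.
Qed.

Lemma orbit_closure_entropy (y0 : orbit_closure y) :
  topological_entropy T = 0%E -> topological_entropy (@orbit_shift R X y) = 0%E.
Proof.
move=> ent0; have T0 := (topological_entropy_eq0P T (y 0%N)).1 ent0.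
apply: (topological_entropy_eq0P _ y0).2 => e h e0 h0.
pose d := e / 5.
have d0 : 0 < d by rewrite divr_gt0.
have [L Ld] : exists L : nat, L.+1%:R^-1 <= 4 * d.
  exists (Num.truncn (4 * d)^-1).
  by rewrite -[leRHS]invrK lef_pV2 ?posrE ?invr_gt0 ?mulr_gt0// ltW// truncnS_gt.
(* The count will be at most a product of three factors exp(s (n+L)), and n + L <= 2 n because n >=
   L; hence 6 s = h. *)
pose s := h / 6; have s0 : 0 < s by rewrite divr_gt0.
have [N1 _ N1P] := T0 d s d0 s0.
have [N2 _ N2P] := linear_le_expR s0.
exists (maxn (maxn N1 N2) L) => // n /=; rewrite !geq_max => /andP[/andP[nN1 nN2] nL].
have [|F spF cF] := N1P (n + L)%N; first by rewrite /=; lia.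
have N2n := N2P (n + L)%N (leq_trans nN2 (leq_addr _ _)).
have de : 4 * d < e by rewrite /d; lra.
have [G spG cG] := orbit_closure_spanning d0 de Ld spF.
exists G => //; rewrite -(ler_nat R) in cG; apply: le_trans cG _.
set E := expR (s * (n + L)%:R) in cF N2n.
have F0 : (0 < #|` F|)%N.
  by rewrite cardfs_gt0; have [a aF _] := spF (y 0); apply/fset0Pn; exists a.
(* As [F] is nonempty, the n + L early windows are absorbed into the product. *)
have : ((n + L) + (n + L).+1 * (#|` F| * #|` F|) <=
        (2 * (n + L) + 1) * (#|` F| * #|` F|))%N.
  have : (0 < #|` F| * #|` F|)%N by rewrite muln_gt0 F0.
  by move: (muln _ _) (addn n L) => S m; nia.
rewrite -(ler_nat R) => /le_trans; apply.
apply: (@le_trans _ _ (E * (E * E))).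
  by rewrite !natrM !ler_pM ?mulr_ge0// natrM.
rewrite /E -!expRD ler_expR.
have : (n + L)%:R <= 2 * n%:R :> R by rewrite -natrM ler_nat; lia.
move=> /(ler_wpM2l (ltW s0)); rewrite /s; lra.
Qed.

End OneSwitch.


(** * Bounds for continuous functions and Möbius averages *)

Lemma complex_real_le_nat (R : realType) (z : R[i]) :
  z \is Num.real -> exists n : nat, z <= n%:R.
Proof.
move=> /complex_realP[k ->]; exists (Num.truncn k).+1.
by rewrite -(rmorph_nat (real_complex R)) lecR ltW// truncnS_gt.
Qed.

(** Points where |f| exceeds n would cluster at some [p], near which |f| <= |f p| + 1. *)
Lemma compact_complex_bounded (R : realType) (X : topologicalType)
    (f : X -> R[i]) :
  compact [set: X] -> continuous f -> exists M : nat, forall x, `|f x| <= M%:R.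
Proof.
move=> cX cf; apply: contrapT => /forallNP unbounded.
have x_ (n : nat) : {x | ~ `|f x| <= n%:R}.
  by apply: cid; apply/existsNP; exact: unbounded.
have [//|p [_ clp]] := cX ((fun n => sval (x_ n)) @ \oo) _; first exact: filterT.
have [K pK] : exists K : nat, `|f p| + 1 <= K%:R.
  by apply: complex_real_le_nat; rewrite realD ?normr_real ?real1.
have fp : nbhs p [set x | `|f x| <= K%:R].
  move: (cf p) => /cvgrPdist_lt/(_ 1 ltr01); apply: filterS => x /= fpx.
  apply: le_trans pK.
  rewrite -[f x](subrK (f p)) addrC (le_trans (ler_normD _ _))// lerD2l.
  by rewrite distrC ltW.
have xK : ((fun n => sval (x_ n)) @ \oo) [set x | ~ `|f x| <= K%:R].
  exists K => // n /= Kn fK; apply: (svalP (x_ n)).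
  by rewrite (le_trans fK)// ler_nat.
by have [x [/= nfx fx]] := clp _ _ xK fp.
Qed.

Lemma norm_mobius_le1 (K : numDomainType) n : `|(mobius n)%:~R : K| <= 1.
Proof.
rewrite /mobius; case: ifP => _; last by rewrite mulr0z normr0 ler01.
by rewrite rmorphXn /= rmorphN1 normrX normrN1 expr1n.
Qed.

(** The terms after N' cancel; each earlier pair differs by at most 2 M, since the Möbius function
    has modulus at most 1. *)
Lemma mobius_average_dist (R : realType) (X Y : Type) (T : X -> X) (S : Y -> Y)
    (f : X -> R[i]) (g : Y -> R[i]) (N N' M : nat) (x : X) (y : Y) :
  (N' <= N)%N ->
  (forall x, `|f x| <= M%:R) -> (forall y, `|g y| <= M%:R) ->
  (forall n, (N' < n <= N)%N -> f (iter n T x) = g (iter n S y)) ->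
  `|mobius_average T f N x - mobius_average S g N y| <= (2 * M * N')%:R / N%:R.
Proof.
move=> N'N fM gM fg; rewrite /mobius_average -mulrBr -sumrB normrM.
rewrite [X in _ <= X]mulrC normfV normr_nat ler_wpM2l ?invr_ge0//.
rewrite (@big_cat_nat _ _ _ N'.+1)//= [X in _ + X]big_nat_cond.
rewrite [X in _ + X]big1 ?addr0 => [|n]; last first.
  by rewrite andbT ltnS => nN; rewrite fg ?subrr.
apply: le_trans (ler_norm_sum _ _ _) _.
apply: (@le_trans _ _ (\sum_(1 <= n < N'.+1) (2 * M)%:R)); last first.
  by rewrite sumr_const_nat subn1 (natrM _ (2 * M)) mulr_natr.
apply: ler_sum => n _; rewrite -mulrBl normrM -[leRHS]mulr1.
apply: ler_pM => //; last exact: norm_mobius_le1.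
by rewrite mul2n -addnn natrD (le_trans (ler_normB _ _))// lerD.
Qed.

(** * Concatenation of orbit segments along rapidly growing times *)

Section Concatenation.
Variables (X : Type) (T : X -> X) (N : nat -> nat) (x : nat -> X).
Hypothesis N_growth : forall k, (2 * (N k).+1 <= N k.+1)%N.

Lemma growth_homo k l : (k <= l)%N -> (N k <= N l)%N.
Proof.
move=> /subnK <-; elim: (l - k)%N => [//|m IH].
by rewrite addSn; apply: leq_trans IH _; have := N_growth (m + k); lia.
Qed.

Lemma growth_unbounded n : exists k, (n <= N k)%N.
Proof.
exists n; elim: n => [//|n IH]; apply: leq_trans (N_growth n); lia.
Qed.

Definition segment n : nat := ex_minn (growth_unbounded n).

Lemma segmentE k n : (N k < n <= N k.+1)%N -> segment n = k.+1.
Proof.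
move=> /andP[kn nk]; rewrite /segment; case: ex_minnP => m nm min_m.
apply/eqP; rewrite eqn_leq min_m//= ltnNge; apply/negP => mk.
by have := growth_homo mk; lia.
Qed.

Definition concatenation n : X := iter n T (x (segment n)).

(** With [k] the segment of [j], i < n <= j <= N k gives i + j < 2 N k <= N k.+1, so the window
    stays in the segments k and k+1. *)
Lemma concatenation_switch n j : (n <= j)%N ->
  exists m a b, forall i, (i < n)%N ->
    concatenation (i + j) = iter i T (if (i < m)%N then a else b).
Proof.
move=> nj; pose k := segment j.
have [jk min_k] : (j <= N k)%N /\ forall l, (j <= N l)%N -> (k <= l)%N.
  by rewrite /k /segment; case: ex_minnP.
(* The switch occurs at the first i with i + j > N k; both orbits are taken at time [j], as time is
   not shifted. *)
exists ((N k).+1 - j)%N, (iter j T (x k)), (iter j T (x k.+1)) => i i_n.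
rewrite /concatenation iterD; congr (iter i T _); rewrite ltn_subRL addnC ltnS.
case: leqP => ik; last first.
  by rewrite (@segmentE k)// ik /=; have := N_growth k; lia.
congr (iter j T (x _)); rewrite /segment; case: ex_minnP => l ijl min_l.
by apply/eqP; rewrite eqn_leq min_l// min_k//; lia.
Qed.

End Concatenation.

(** * Uniform convergence from Sarnak's conjecture *)

Theorem corollary10 (R : realType) (hSarnak : Sarnak_conjecture R)
  (X : metricType R) (T : X -> X) (hT : is_tds T)
  (hent : topological_entropy T = 0%E)
  (f : X -> R[i]) (hf : continuous f) :
  {uniform, (fun N : nat => mobius_average T f N) @ \oo --> (fun _ : X => (0 : R[i]))}.
Proof.
have [cX _] := hT; have [M fM] := compact_complex_bounded cX hf.
move=> P /uniform_nbhs[E [entE EP]].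
move: entE; rewrite -entourage_ballE => -[e /= e0 eE].
suff [N0 small] : exists N0, forall N x, (N0 <= N)%N -> `|mobius_average T f N x| < e.
  exists N0 => // N /= N0N; apply: EP => x _; apply: eE => /=.
  by rewrite -ball_normE /= sub0r normrN small.
apply: contrapT => /forallNP large.
have bad N0 : {Nx : nat * X | (N0 <= Nx.1)%N /\ ~ `|mobius_average T f Nx.1 Nx.2| < e}.
  apply: cid; have /existsNP[N /existsNP[x /not_implyP[N0N nsmall]]] := large N0.
  by exists (N, x).
have e20 : 0 < e / 2 by rewrite divr_gt0.
(* The choice of [c] yields 2 M N_k <= (e/2) N_{k+1}; the summand 2 in the growth factor gives the
   doubling. *)
have [c cM] : exists c : nat, (2 * M)%:R / (e / 2) <= c%:R.
  by apply: complex_real_le_nat; rewrite realE divr_ge0// ltW.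
pose Nx := fix Nx k := if k is l.+1 then sval (bad ((c + 2) * (Nx l).1.+1)%N)
                       else sval (bad 0%N).
pose N k := (Nx k).1; pose x k := (Nx k).2.
have N_growth_c k : ((c + 2) * (N k).+1 <= N k.+1)%N.
  by have [] := svalP (bad ((c + 2) * (Nx k).1.+1)%N).
have N_growth k : (2 * (N k).+1 <= N k.+1)%N.
  by apply: leq_trans (N_growth_c k); rewrite leq_mul2r leq_addl orbT.
have large_Nx k : ~ `|mobius_average T f (N k.+1) (x k.+1)| < e.
  by have [] := svalP (bad ((c + 2) * (Nx k).1.+1)%N).
pose y := concatenation T x N_growth.
(* [y] lies in its own orbit closure, with offset j = 0. *)
have yP (L : nat) (d : R) : 0 < d ->
    exists j, forall i, (i < L)%N -> mdist (y i) (y (i + j)%N) < d.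
  by move=> d0; exists 0%N => i _; rewrite addn0 mdistxx.
pose y0 : orbit_closure y := exist _ y yP.
have /cvgrPdist_lt/(_ _ e20)[N0 _ y_small] :=
  hSarnak _ _ (orbit_shift_tds y cX)
    (orbit_closure_entropy (concatenation_switch T x N_growth) y0 hent)
    _ (coord0_continuous hf) y0.
have [k N0k] := growth_unbounded N_growth N0.
have N0k1 : (N0 <= N k.+1)%N by have := N_growth k; lia.
apply: (large_Nx k).
have := y_small _ N0k1; rewrite /= sub0r normrN => small_y.
(* The average along [y] at time N k.+1 is below e/2 by Sarnak's conjecture; its difference from the
   average at [x k.+1] comes from the n <= N k only. *)
rewrite -[X in `|X|](subrK (mobius_average (@orbit_shift R X y)
  (fun w : orbit_closure y => f (sval w 0%N)) (N k.+1) y0)).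
rewrite [X in _ < X](splitr e); apply: le_lt_trans (ler_normD _ _) _.
apply: ler_ltD small_y.
apply: le_trans (@mobius_average_dist _ _ _ _ _ _ _ _ (N k) M _ _ _ _ _ _) _ => //.
- by have := N_growth k; lia.
- move=> n nN; rewrite iter_orbit_shiftE /= add0n /y /concatenation.
  by rewrite (segmentE _ nN).
have Npos : 0 < (N k.+1)%:R :> R[i] by rewrite ltr0n; have := N_growth k; lia.
rewrite ler_pdivrMr// natrM.
move: cM; rewrite ler_pdivrMr// => /ler_wpM2r; move=> /(_ (N k)%:R (ler0n _ _)).
move=> /le_trans; apply; rewrite mulrAC mulrC ler_wpM2l//; first exact: ltW.
by rewrite -natrM ler_nat; have := N_growth_c k; nia.
Qed.
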